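(* Let $\mathbb{P}$ be a stationary, ergodic probability measure on $\{0,1\}^{\mathbb{N}}$ (a stationary, ergodic classical information source). Then for every $\alpha\in[0,1)\cup(1,\infty]$, $$\lim_{\epsilon\to 0} h_\alpha^\epsilon(\mathbb{P}) = h(\mathbb{P}),$$ where $h(\mathbb{P})$ is the Shannon entropy rate of $\mathbb{P}$ and $h_\alpha^\epsilon(\mathbb{P})$ is its $\epsilon$-smooth Rényi entropy rate of order $\alpha$.
   Context: Stationary and ergodic are meant with respect to the left shift on $\{0,1\}^{\mathbb{N}}$. Logarithms are natural. For $n\in\mathbb{N}$, $\mathbb{P}^n$ is the probability distribution on $\{0,1\}^n$ obtained by restricting $\mathbb{P}$ to coordinates $0,\ldots,n-1$, i.e. its $n$-dimensional marginal. Rényi entropy. For a possibly non-normalized distribution $\mathbb{Q}$ on a finite set $\mathcal{Z}$ (so $\mathbb{Q}(z)\ge 0$ and $\sum_z \mathbb{Q}(z)\le 1$) and $0<\alpha<\infty$, $\alpha\ne 1$, $H_\alpha(\mathbb{Q})=\frac{1}{1-\alpha}\log\sum_{z\in\mathcal{Z}}\mathbb{Q}(z)^\alpha$. For $\alpha=0$ and $\alpha=\infty$ it is defined by taking limits in the order: $H_0(\mathbb{Q})=\log|\{z:\mathbb{Q}(z)>0\}|$ and $H_\infty(\mathbb{Q})=-\log\max_z\mathbb{Q}(z)$. $H$ denotes Shannon entropy. Smooth Rényi entropy. For a probability distribution $\mathbb{P}$ on $\mathcal{Z}$ and $\epsilon\ge 0$, let $\mathcal{B}^\epsilon(\mathbb{P})=\{\mathbb{Q}: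 \sum_{z\in\mathcal{Z}}\mathbb{Q}(z)\ge 1-\epsilon,\ 0\le\mathbb{Q}(z)\le\mathbb{P}(z)\ \forall z\in\mathcal{Z}\}$. Then $H_\alpha^\epsilon(\mathbb{P})=\inf_{\mathbb{Q}\in\mathcal{B}^\epsilon(\mathbb{P})}H_\alpha(\mathbb{Q})$ for $0\le\alpha<1$, and $H_\alpha^\epsilon(\mathbb{P})=\sup_{\mathbb{Q}\in\mathcal{B}^\epsilon(\mathbb{P})}H_\alpha(\mathbb{Q})$ for $1<\alpha\le\infty$. Rates. $h(\mathbb{P})=\lim_{n\to\infty}\frac1n H(\mathbb{P}^n)$ and $h_\alpha^\epsilon(\mathbb{P})=\lim_{n\to\infty}\frac1n H_\alpha^\epsilon(\mathbb{P}^n)$. *)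

(* Defs.v *)
(* MathComp-Analysis *)
From HB Require Import structures.
From mathcomp Require Import all_boot all_order all_algebra.
From mathcomp Require Import all_classical all_reals all_analysis.
Set Implicit Arguments.
Unset Strict Implicit.
Unset Printing Implicit Defensive.
Import Order.TTheory GRing.Theory Num.Theory.
Import numFieldNormedType.Exports.
Local Open Scope classical_set_scope.
Local Open Scope ring_scope.

Definition cylinder (n : nat) (w : n.-tuple bool) : set (nat -> bool) :=
  [set x | forall i : 'I_n, x i = tnth w i].

Definition cylinders : set (set (nat -> bool)) :=
  [set C | exists (n : nat) (w : n.-tuple bool), C = cylinder w].

(* {0,1}^N with its product sigma-algebra. *)
Definition binseq := g_sigma_algebraType cylinders.

Definition shift (x : binseq) : binseq := fun n => x n.+1.

Definition stationary (R : realType) (P : probability binseq R) : Prop :=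
  forall A : set binseq, measurable A -> P (shift @^-1` A) = P A.

Definition ergodic (R : realType) (P : probability binseq R) : Prop :=
  forall A : set binseq, measurable A -> shift @^-1` A = A ->
    P A = 0%E \/ P A = 1%E.

(* Distributions on a finite set are given by their mass functions. *)
Definition marginal (R : realType) (P : probability binseq R) (n : nat) :
    n.-tuple bool -> R :=
  fun w => fine (P (cylinder w)).

(* The convention 0 log 0 = 0 holds because of the factor p z. *)
Definition shannon_entropy (R : realType) (Z : finType) (p : Z -> R) : R :=
  - \sum_(z : Z) p z * ln (p z).

(* Values are extended reals because the zero mass function is allowed:
   lne 0 = -oo.  The order 0 needs its own clause since 0 `^ 0 = 1.
   The orders 1 and -oo are outside the intended domain. *)
Definition renyi_entropy (R : realType) (Z : finType) (a : \bar R)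
    (q : Z -> R) : \bar R :=
  match a with
  | r%:E => if r == 0 then lne (#|[pred z : Z | 0 < q z]|%:R)%:E
            else (((1 - r)^-1)%:E * lne (\sum_(z : Z) q z `^ r)%:E)%E
  | +oo%E => (- lne (\big[Num.max/0]_(z : Z) q z)%:E)%E
  | -oo%E => 0%E
  end.

Definition smoothing_set (R : realType) (Z : finType) (e : R) (p : Z -> R) :
    set (Z -> R) :=
  [set q : Z -> R | 1 - e <= \sum_(z : Z) q z /\ forall z, 0 <= q z <= p z].

Definition smooth_renyi_entropy (R : realType) (Z : finType) (a : \bar R)
    (e : R) (p : Z -> R) : \bar R :=
  if (a < 1)%E
  then ereal_inf [set renyi_entropy a q | q in smoothing_set e p]
  else ereal_sup [set renyi_entropy a q | q in smoothing_set e p].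

(* 0^-1 = 0; the term at n = 0 is irrelevant for the limits. *)
Definition block_entropy (R : realType) (P : probability binseq R) : R^nat :=
  fun n => n%:R^-1 * shannon_entropy (marginal P (n := n)).

Definition entropy_rate (R : realType) (P : probability binseq R) : R :=
  limn (block_entropy P).

Definition block_smooth_renyi (R : realType) (P : probability binseq R)
    (a : \bar R) (e : R) : (\bar R)^nat :=
  fun n => ((n%:R^-1)%:E * smooth_renyi_entropy a e (marginal P (n := n)))%E.

Definition smooth_renyi_rate (R : realType) (P : probability binseq R)
    (a : \bar R) (e : R) : \bar R :=
  limn (block_smooth_renyi P a e).

(* Main.v *)
(* The Shannon-McMillan theorem in probability is enough: if all but a small
   mass of p lies on words with exp(-t2) <= p z <= exp(-t1), then every smooth
   Renyi entropy of p lies between t1 and t2 up to a constant.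

   Upper half of Shannon-McMillan: by Markov's inequality P(x_0..x_(n-1)) is
   rarely much smaller than the k-step Markov approximation of P, whose log
   is a Birkhoff sum; by the maximal ergodic inequality this sum is at most
   n (d_k + o(1)), where d_k is the k-th conditional entropy, and inf_k d_k is
   the entropy rate.  Lower half: the mean of -log P(x_0..x_(n-1)) is at least
   n times the rate, so it cannot be much smaller on a set of positive mass. *)
Require Import Defs.
From mathcomp Require Import all_boot all_order all_algebra.
From mathcomp Require Import all_classical all_reals all_analysis.
From mathcomp Require Import ring lra.
Import Order.TTheory GRing.Theory Num.Theory.
Import numFieldNormedType.Exports.
Local Open Scope classical_set_scope.
Local Open Scope ring_scope.
Set Implicit Arguments.
Unset Strict Implicit.
Unset Printing Implicit Defensive.
Local Notation shift := Defs.shift.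

(** * Words and cylinders *)

Definition word n (x : binseq) : n.-tuple bool := [tuple x i | i < n].

Definition scons b (x : binseq) : binseq :=
  fun i => if i is j.+1 then x j else b.

(** Padding with [false] lets a function of sequences be evaluated at a word, so that expectations
    of functions of finitely many coordinates become finite sums. *)
Definition ext (w : seq bool) : binseq := nth false w.

Definition local n (T : Type) (F : binseq -> T) :=
  forall x y, word n x = word n y -> F x = F y.

Lemma wordP n (x y : binseq) :
  (forall i, (i < n)%N -> x i = y i) <-> word n x = word n y.
Proof.
split=> [xy|xy i lin]; first by apply: eq_from_tnth => i; rewrite !tnth_mktuple xy.
by have := congr1 (fun w => tnth w (Ordinal lin)) xy; rewrite !tnth_mktuple.
Qed.

Lemma cylinderE n (w : n.-tuple bool) : cylinder w = [set x | word n x = w].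
Proof.
apply/seteqP; split=> x /=.
  by move=> xw; apply: eq_from_tnth => i; rewrite tnth_mktuple xw.
by move=> <- i; rewrite tnth_mktuple.
Qed.

Lemma word_ext n (w : n.-tuple bool) : word n (ext w) = w.
Proof. by apply: eq_from_tnth => i; rewrite tnth_mktuple (tnth_nth false). Qed.

Lemma word_le m n x y : (m <= n)%N -> word n x = word n y -> word m x = word m y.
Proof.
by move=> mn /wordP xy; apply/wordP => i im; apply: xy; apply: leq_trans mn.
Qed.

Lemma word_shift n x y :
  word n.+1 x = word n.+1 y -> word n (shift x) = word n (shift y).
Proof. by move=> /wordP xy; apply/wordP => i lin; apply: xy. Qed.

Lemma local_ext n T (F : binseq -> T) x : local n F -> F (ext (word n x)) = F x.
Proof. by move=> lF; apply: lF; rewrite word_ext. Qed.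

Lemma local_le m n T (F : binseq -> T) : (m <= n)%N -> local m F -> local n F.
Proof. by move=> mn lF x y /(word_le mn)/lF. Qed.

Lemma local_word n : local n (word n).
Proof. by []. Qed.

Lemma local_shift n T (F : binseq -> T) : local n F -> local n.+1 (F \o shift).
Proof. by move=> lF x y /word_shift/lF. Qed.

Lemma local_map n T U (F : binseq -> T) (g : T -> U) :
  local n F -> local n (fun x => g (F x)).
Proof. by move=> lF x y /lF ->. Qed.

Lemma shift_scons b x : shift (scons b x) = x.
Proof. by []. Qed.

Lemma sum_word_cons (R : realType) n (G : binseq -> R) :
  \sum_(w : n.+1.-tuple bool) G (ext w) =
  \sum_(w : n.-tuple bool) (G (scons true (ext w)) + G (scons false (ext w))).
Proof.
have extE (w : n.+1.-tuple bool) :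
    ext w = scons (thead w) (ext (behead_tuple w)).
  by apply/funext => -[|i]; case/tupleP: w => b w; rewrite ?theadE.
rewrite (reindex (fun bw : bool * n.-tuple bool => [tuple of bw.1 :: bw.2])) /=;
  last first.
  exists (fun w => (thead w, behead_tuple w)) => [[b w] _|w _] /=.
    by rewrite theadE; congr pair; apply: val_inj.
  by rewrite [RHS]tuple_eta; apply: val_inj.
rewrite -(pair_bigA _ (fun b (w : n.-tuple bool) => G (ext [tuple of b :: w]))) /=.
rewrite big_bool /= -big_split /=.
apply: eq_bigr => w _.
by congr (G _ + G _); rewrite extE theadE; congr scons; congr ext.
Qed.

(** * Masses, means and probabilities over words of a fixed length *)

Section Source.
Variables (R : realType) (P : probability binseq R).

Definition wmass n (x : binseq) : R := marginal P (word n x).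

(** This is the expectation of [F] under [P] as soon as [F] is [local n]. *)
Definition mean n (F : binseq -> R) : R :=
  \sum_(w : n.-tuple bool) marginal P w * F (ext w).

Definition pr n (A : pred binseq) : R :=
  \sum_(w : n.-tuple bool | A (ext w)) marginal P w.

Lemma measurable_cylinder n (w : n.-tuple bool) :
  measurable (cylinder w : set binseq).
Proof. by apply: sub_sigma_algebra; exists n, w. Qed.

Lemma event_bigcup n (A : pred binseq) : local n A ->
  [set x : binseq | A x] =
  \bigcup_(w in [set` (fun w : n.-tuple bool => A (ext w))]) cylinder w.
Proof.
move=> lA; apply/seteqP; split=> x.
  move=> /= Ax; exists (word n x); last by rewrite cylinderE.
  by rewrite /= -topredE /= (local_ext _ lA).
by move=> [w Aw]; rewrite cylinderE /= => xw; rewrite -(local_ext _ lA) xw.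
Qed.

Lemma measurable_event n (A : pred binseq) : local n A ->
  measurable [set x : binseq | A x].
Proof.
move=> /event_bigcup ->; apply: fin_bigcup_measurable => [|w _].
  exact: finite_finset.
exact: measurable_cylinder.
Qed.

Lemma marginalE n (w : n.-tuple bool) : P (cylinder w) = (marginal P w)%:E.
Proof. by rewrite fineK // fin_num_measure //; exact: measurable_cylinder. Qed.

Lemma marginal_ge0 n (w : n.-tuple bool) : 0 <= marginal P w.
Proof. by rewrite fine_ge0. Qed.

Lemma prob_event n (A : pred binseq) : local n A ->
  P [set x | A x] = (pr n A)%:E.
Proof.
move=> lA; rewrite (event_bigcup lA) measure_fin_bigcup.
- rewrite -(@bigfs _ _ _ _ (index_enum _)) ?index_enum_uniq //; last first.
    by move=> w; rewrite mem_index_enum.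
  rewrite /pr -sumEFin; apply: eq_bigr => w _; exact: marginalE.
- exact: finite_finset.
- by move=> w v _ _ [x []]; rewrite !cylinderE => <- <-.
- by move=> w _; exact: measurable_cylinder.
Qed.

Lemma sum_marginal n : \sum_(w : n.-tuple bool) marginal P w = 1.
Proof.
have := @prob_event n predT (fun _ _ _ => erefl).
rewrite (_ : [set x | predT x] = setT) ?probability_setT; last exact/seteqP.
by move=> P1; apply: EFin_inj; rewrite [RHS]P1.
Qed.

(** Words [w] are grouped by the first m letters of [phi (ext w)]; each class has the mass of the
    preimage of a cylinder. Taking [phi] to be the identity or the shift gives widening and shift
    invariance of means. *)
Lemma mean_transport m n (F : binseq -> R) (phi : binseq -> binseq) :
  local m F -> local n (word m \o phi) ->
  (forall v : m.-tuple bool, P (phi @^-1` cylinder v) = P (cylinder v)) ->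
  mean n (F \o phi) = mean m F.
Proof.
move=> lF lphi Pphi; rewrite /mean.
rewrite (partition_big (fun w : n.-tuple bool => word m (phi (ext w))) predT) //=.
apply: eq_bigr => v _.
rewrite (eq_bigr (fun w : n.-tuple bool => marginal P w * F (ext v))).
  rewrite -mulr_suml; congr (_ * _); apply: EFin_inj; rewrite -marginalE -Pphi.
  have lA : local n [pred x | word m (phi x) == v].
    by move=> x y /lphi /= ->.
  rewrite -[LHS](prob_event lA); congr (P _).
  by rewrite cylinderE; apply/seteqP; split=> x /= /eqP.
by move=> w /eqP <-; congr (_ * _); apply: lF; rewrite word_ext.
Qed.

Lemma mean_widen m n (F : binseq -> R) : (m <= n)%N -> local m F ->
  mean n F = mean m F.
Proof.
move=> mn lF; apply: (@mean_transport m n F id) => //.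
exact: local_le mn (@local_word m).
Qed.

Lemma mean_shift n (F : binseq -> R) : stationary P -> local n F ->
  mean n.+1 (F \o shift) = mean n F.
Proof.
move=> Pst lF; apply: mean_transport => // [|v].
  exact: local_shift (@local_word n).
by apply: Pst; exact: measurable_cylinder.
Qed.

Lemma meanD n F G : mean n (fun x => F x + G x) = mean n F + mean n G.
Proof. by rewrite -big_split; apply: eq_bigr => w _; rewrite mulrDr. Qed.

Lemma meanZ n c F : mean n (fun x => c * F x) = c * mean n F.
Proof. by rewrite mulr_sumr; apply: eq_bigr => w _; rewrite mulrCA. Qed.

Lemma mean_cst n c : mean n (fun=> c) = c.
Proof. by rewrite /mean -mulr_suml sum_marginal mul1r. Qed.

Lemma ler_mean n F G :
  (forall w : n.-tuple bool, 0 < marginal P w -> F (ext w) <= G (ext w)) ->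
  mean n F <= mean n G.
Proof.
move=> FG; apply: ler_sum => w _; have := marginal_ge0 w.
rewrite le_eqVlt => /predU1P[<-|w0]; first by rewrite !mul0r.
by rewrite ler_pM2l // FG.
Qed.

Lemma eq_mean n F G :
  (forall w : n.-tuple bool, 0 < marginal P w -> F (ext w) = G (ext w)) ->
  mean n F = mean n G.
Proof. by move=> FG; apply/le_anti/andP; split; apply: ler_mean => w /FG ->. Qed.

Lemma wmassE n (w : n.-tuple bool) : wmass n (ext w) = marginal P w.
Proof. by rewrite /wmass word_ext. Qed.

Lemma local_wmass n : local n (wmass n).
Proof. exact: local_map. Qed.

Lemma wmass_ge0 n x : 0 <= wmass n x.
Proof. exact: marginal_ge0. Qed.

Lemma wmass_le1 n x : wmass n x <= 1.
Proof.
rewrite -(sum_marginal n) (bigD1 (word n x)) //= lerDl sumr_ge0 // => w _.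
exact: marginal_ge0.
Qed.

Lemma wmass_leS n x : wmass n.+1 x <= wmass n x.
Proof.
rewrite -lee_fin -!marginalE.
apply: le_measure; rewrite ?inE; try exact: measurable_cylinder.
by rewrite !cylinderE => y /=; exact: word_le.
Qed.

Lemma wmass_le_shift n x : stationary P -> wmass n.+1 x <= wmass n (shift x).
Proof.
move=> Pst; rewrite -lee_fin -!marginalE -[leRHS]Pst;
  last exact: measurable_cylinder.
apply: le_measure; rewrite ?inE; [exact: measurable_cylinder| |].
  rewrite (_ : _ @^-1` _ = [set y | word n (shift y) == word n (shift x)]).
    apply: (@measurable_event n.+1 [pred y | word n (shift y) == word n (shift x)]).
    by move=> y z /word_shift /= ->.
  by rewrite cylinderE; apply/seteqP; split=> y /= /eqP.
by rewrite !cylinderE => y /=; exact: word_shift.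
Qed.

(** By stationarity the indicator of the first n letters of [x] keeps its mean under the shift;
    splitting the shifted mean by the head letter leaves the two left extensions of that word. *)
Lemma wmass_scons n x : stationary P ->
  wmass n.+1 (scons true x) + wmass n.+1 (scons false x) = wmass n x.
Proof.
move=> Pst; pose F y : R := (word n y == word n x)%:R.
have lF : local n F by move=> y z yz; rewrite /F yz.
have mF : mean n F = wmass n x.
  rewrite /mean (bigD1 (word n x)) // /F word_ext eqxx mulr1 big1 /= ?addr0 //.
  by move=> w /negPf wx; rewrite word_ext wx mulr0.
rewrite -mF -(mean_shift Pst lF) /mean.
rewrite (eq_bigr (fun w : n.+1.-tuple bool =>
    wmass n.+1 (ext w) * F (shift (ext w)))).
  rewrite (sum_word_cons _ (fun y => wmass n.+1 y * F (shift y))) (bigD1 (word n x)) //.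
  rewrite !shift_scons {1 2}/F word_ext eqxx !mulr1 big1 /= ?addr0.
    by congr (_ + _); apply: local_wmass; apply/wordP => -[|i] //= lin;
       move/wordP: (word_ext (word n x)) => ->.
  by move=> w /negPf wx; rewrite /F !shift_scons word_ext wx !mulr0 addr0.
by move=> w _; rewrite wmassE.
Qed.

End Source.

(** * Entropy and Markov approximation *)

Fixpoint birkhoff (R : realType) (f : binseq -> R) n (x : binseq) : R :=
  if n is m.+1 then f x + birkhoff f m (shift x) else 0.

Lemma local_birkhoff (R : realType) (f : binseq -> R) k n :
  local k f -> local (n + k) (birkhoff f n).
Proof.
move=> lf; elim: n => [//|n ih] x y xy /=.
rewrite (lf _ _ (word_le _ xy)) ?leqW ?leq_addl //.
by rewrite (ih _ _ (word_shift xy)).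
Qed.

(** This is [ln u <= u - 1] at [u = q / p]. It is stated for a single term because the lower half of
    Shannon-McMillan applies it to some words only. *)
Lemma gibbs_term (R : realType) (p q : R) : 0 <= p -> 0 <= q ->
  (0 < p -> 0 < q) -> p * - ln p <= p * - ln q + (q - p).
Proof.
rewrite le_eqVlt => /predU1P[<- q0 _|p0 _ /(_ p0) q0].
  by rewrite !mul0r add0r subr0.
have : ln (1 + (q / p - 1)) <= q / p - 1.
  by apply: le_ln1Dx; rewrite ltrBrDl addrN divr_gt0.
rewrite addrC subrK ln_div ?posrE // => /(ler_wpM2l (ltW p0)).
rewrite !mulrBr mulr1 (mulrCA p q) divff ?gt_eqF //; lra.
Qed.

(** Nonnegativity of relative entropy, in a form that admits a reference [q] of smaller total
    mass. *)
Lemma gibbs (R : realType) (Z : finType) (p q : Z -> R) :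
  (forall z, 0 <= p z) -> (forall z, 0 <= q z) ->
  (forall z, 0 < p z -> 0 < q z) ->
  \sum_z q z <= \sum_z p z ->
  \sum_z p z * - ln (p z) <= \sum_z p z * - ln (q z).
Proof.
move=> p0 q0 pq qp; rewrite -subr_ge0.
have : \sum_z p z * - ln (p z) <= \sum_z (p z * - ln (q z) + (q z - p z)).
  by apply: ler_sum => z _; exact: gibbs_term (p0 z) (q0 z) (pq z).
rewrite big_split sumrB /=; lra.
Qed.

Section Markov.
Variables (R : realType) (P : probability binseq R).
Hypothesis Pst : stationary P.

(* The transition probabilities run backwards in time, so that a word grows at
   its head. *)
Definition cond k (x : binseq) : R := wmass P k.+1 x / wmass P k (shift x).

(** The k-step Markov approximation of [P] on words of length n + k: the last k letters carry their
    exact mass, and each earlier letter is drawn given the k letters after it. *)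
Fixpoint bmarkov k n (x : binseq) : R :=
  if n is m.+1 then cond k x * bmarkov k m (shift x) else wmass P k x.

Lemma local_cond k : local k.+1 (cond k).
Proof.
move=> x y xy; rewrite /cond (local_wmass P xy).
by rewrite (local_wmass P (word_shift xy)).
Qed.

Lemma local_bmarkov k n : local (n + k) (bmarkov k n).
Proof.
elim: n => [|n ih] x y xy /=; first exact: local_wmass.
rewrite (local_cond (word_le _ xy)) ?ltnS ?leq_addl //.
by rewrite (ih _ _ (word_shift xy)).
Qed.

Lemma bmarkov_ge0 k n x : 0 <= bmarkov k n x.
Proof.
elim: n x => [|n ih] x /=; first exact: wmass_ge0.
by rewrite mulr_ge0 // divr_ge0 // wmass_ge0.
Qed.

Lemma sum_bmarkov_le1 k n :
  \sum_(w : (n + k).-tuple bool) bmarkov k n (ext w) <= 1.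
Proof.
elim: n => [|n ih].
  rewrite -(sum_marginal P k) /=; by apply: ler_sum => w _; rewrite wmassE.
rewrite (sum_word_cons _ (bmarkov k n.+1)) (le_trans _ ih) //.
apply: ler_sum => w _ /=; rewrite -mulrDl ler_piMl ?bmarkov_ge0 //.
rewrite /cond -mulrDl wmass_scons // shift_scons.
(* The two transition weights sum to 1, or to 0 when the word they extend has mass zero. *)
by have [->|w0] := eqVneq (wmass P k (ext w)) 0; rewrite ?mul0r ?divff.
Qed.

Definition info n (x : binseq) : R := - ln (wmass P n x).

Definition cinfo k (x : binseq) : R := - ln (cond k x).

Lemma local_info n : local n (info n).
Proof. by move=> x y /(@local_wmass _ P n) xy; rewrite /info xy. Qed.

Lemma local_cinfo k : local k.+1 (cinfo k).
Proof. by move=> x y /(@local_cond k) xy; rewrite /cinfo xy. Qed.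

Lemma wmass_gt0_le m n x : (m <= n)%N -> 0 < wmass P n x -> 0 < wmass P m x.
Proof.
move=> /subnK <-; elim: (n - m)%N => [//|j ih] x0.
by apply: ih; apply: lt_le_trans x0 _; exact: wmass_leS.
Qed.

Lemma cond_gt0 k x : 0 < wmass P k.+1 x -> 0 < cond k x.
Proof. by move=> x0; rewrite divr_gt0 // (lt_le_trans x0) // wmass_le_shift. Qed.

Lemma info_ge0 n x : 0 <= info n x.
Proof. by rewrite oppr_ge0 ln_le0 // wmass_le1. Qed.

Lemma cinfo_ge0 k x : 0 <= cinfo k x.
Proof.
rewrite oppr_ge0 ln_le0 // /cond.
have [->|w0] := eqVneq (wmass P k (shift x)) 0; first by rewrite invr0 mulr0.
by rewrite ler_pdivrMr ?mul1r ?wmass_le_shift // lt_neqAle eq_sym w0 wmass_ge0.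
Qed.

Lemma cinfoE k x : 0 < wmass P k.+1 x ->
  cinfo k x = info k.+1 x - info k (shift x).
Proof.
move=> x0; rewrite /cinfo ln_div ?posrE ?(lt_le_trans x0) ?wmass_le_shift //.
by rewrite /info; lra.
Qed.

(** Positive mass of the whole word makes every factor positive, so the logarithm splits: the
    transitions form a Birkhoff sum and the last k letters leave one boundary term. *)
Lemma bmarkovP k n x : 0 < wmass P (n + k) x ->
  0 < bmarkov k n x /\
  - ln (bmarkov k n x) = birkhoff (cinfo k) n x + info k (iter n shift x).
Proof.
elim: n x => [|n ih] x x0; first by rewrite add0r.
have c0 : 0 < cond k x.
  apply: cond_gt0; apply: wmass_gt0_le (x0); rewrite addSn ltnS leq_addl //.
have s0 : 0 < wmass P (n + k) (shift x).
  by rewrite (lt_le_trans x0) // wmass_le_shift.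
have [m0 mE] := ih _ s0.
split; first by rewrite mulr_gt0.
by rewrite iterSr /= lnM ?posrE // opprD mE addrA.
Qed.

(** * Block entropies, conditional entropies and the entropy rate *)

Definition ent n : R := mean P n (info n).

(** The conditional entropy [d_k] of a letter given the k letters after it; by the chain rule [entS]
    it is also the increment of the block entropy. *)
Definition cent k : R := mean P k.+1 (cinfo k).

Lemma entE n : shannon_entropy (marginal P (n:=n)) = ent n.
Proof.
rewrite /shannon_entropy -sumrN; apply: eq_bigr => w _.
by rewrite /info wmassE mulrN.
Qed.

Lemma ent_ge0 n : 0 <= ent n.
Proof.
by apply: sumr_ge0 => w _; rewrite mulr_ge0 ?marginal_ge0 ?info_ge0.
Qed.

Lemma cent_ge0 k : 0 <= cent k.
Proof.
by apply: sumr_ge0 => w _; rewrite mulr_ge0 ?marginal_ge0 ?cinfo_ge0.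
Qed.

Lemma entS k : ent k.+1 = ent k + cent k.
Proof.
rewrite /ent -(mean_shift Pst (@local_info k)) -meanD.
apply: eq_mean => w w0; rewrite cinfoE ?wmassE //=; lra.
Qed.

Lemma mean_birkhoff f k n : local k f ->
  mean P (n + k) (birkhoff f n) = n%:R * mean P k f.
Proof.
move=> lf; elim: n => [|n ih]; first by rewrite mean_cst mul0r.
rewrite addSn meanD (mean_shift Pst (local_birkhoff lf)) ih.
by rewrite (mean_widen _ _ lf) ?leqW ?leq_addl // -natr1 mulrDl mul1r addrC.
Qed.

Lemma local_iter_shift T (f : binseq -> T) k n : local k f ->
  local (n + k) (f \o iter n shift).
Proof.
move=> lf; elim: n => [//|n ih] x y xy.
by rewrite /= -!iterS !iterSr; exact: ih (word_shift xy).
Qed.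

Lemma mean_iter f k n : local k f ->
  mean P (n + k) (f \o iter n shift) = mean P k f.
Proof.
move=> lf; elim: n => [//|n <-].
rewrite -(mean_shift Pst (local_iter_shift (n := n) lf)).
by apply: eq_mean => w _; rewrite /= -iterS iterSr.
Qed.

(** Gibbs' inequality against [bmarkov k n]: by stationarity each transition contributes [cent k] to
    the mean of its negative logarithm, and the boundary block contributes [ent k]. *)
Lemma ent_add_le n k : ent (n + k) <= n%:R * cent k + ent k.
Proof.
have : ent (n + k) <= mean P (n + k) (fun x => - ln (bmarkov k n x)).
  have gt0 (w : (n + k).-tuple bool) : 0 < marginal P w -> 0 < bmarkov k n (ext w).
    by move=> w0; have [] := @bmarkovP k n (ext w); rewrite ?wmassE.
  rewrite /ent /mean; under eq_bigr do rewrite /info wmassE.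
  apply: gibbs => // [w|w|]; [exact: marginal_ge0|exact: bmarkov_ge0|].
  by rewrite sum_marginal sum_bmarkov_le1.
move=> /le_trans; apply.
have lm : local (n + k) (fun x => - ln (bmarkov k n x)).
  by move=> x y /local_bmarkov ->.
(* One more coordinate is added because [cinfo k] reads k + 1 letters. *)
rewrite -(mean_widen P (leqnSn _) lm) -addnS.
have lI := local_iter_shift (n := n) (@local_info k).
rewrite -(mean_birkhoff n (@local_cinfo k)) -[ent k](mean_iter n (@local_info k)).
rewrite -(mean_widen P _ lI (n := n + k.+1)) ?addnS // -addnS -meanD.
apply: ler_mean => w w0; rewrite (bmarkovP _).2 //.
by apply: wmass_gt0_le (_ : 0 < wmass P (n + k.+1) _); rewrite ?wmassE // addnS.
Qed.

(** As an infimum it lies below every [cent k] and is approached by some of them; [cvg_ent]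
    identifies it with the entropy rate. *)
Definition erate : R := inf (range cent).

Lemma erate_ge0 : 0 <= erate.
Proof. by apply: lb_le_inf => [|_ [k _ <-]]; [exists (cent 0), 0|exact: cent_ge0]. Qed.

Lemma erate_le k : erate <= cent k.
Proof.
by apply: ge_inf; [exists 0 => _ [j _ <-]; exact: cent_ge0|exists k].
Qed.

Lemma erate_lt e : 0 < e -> exists k, cent k < erate + e.
Proof.
move=> e0; have [] := @inf_adherent _ (range cent) _ e0.
  by split; [exists (cent 0), 0|exists 0 => _ [j _ <-]; exact: cent_ge0].
by move=> _ [k _ <-]; exists k.
Qed.

Lemma ent_ge n : n%:R * erate <= ent n.
Proof.
elim: n => [|n ih]; first by rewrite mul0r ent_ge0.
by rewrite entS -natr1 mulrDl mul1r lerD // erate_le.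
Qed.

Lemma near_inv_natr_lt (c e : R) : 0 < e -> \forall n \near \oo, c < n%:R * e.
Proof.
move=> e0; near=> n; rewrite -ltr_pdivrMr //.
by near: n; exact: nbhs_infty_gtr.
Unshelve. all: by end_near. Qed.

(** Summing the chain rule gives the lower bound. For the upper bound, k is fixed with [cent k]
    close to the infimum, and [ent k] becomes negligible against n. *)
Lemma cvg_ent : n%:R^-1 * ent n @[n --> \oo] --> erate.
Proof.
apply/cvgrPdist_le => e e0.
have e2 : 0 < e / 2 by rewrite divr_gt0.
have [k kE] := erate_lt e2.
near=> n.
have n0 : 0 < n%:R :> R by rewrite ltr0n; near: n; exact: nbhs_infty_gt.
have kn : (k <= n)%N by near: n; exact: nbhs_infty_ge.
rewrite ler_distlC; apply/andP; split.
  rewrite ler_pdivlMl // (le_trans _ (ent_ge n)) // ler_pM2l // lerBlDr lerDl.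
  exact: ltW.
rewrite ler_pdivrMl // -(subnK kn) (le_trans (ent_add_le _ _)) // subnK //.
have : ent k < n%:R * (e / 2) by near: n; exact: near_inv_natr_lt.
have : (n - k)%:R * cent k <= n%:R * cent k.
  by rewrite ler_wpM2r ?cent_ge0 // ler_nat leq_subr.
have : n%:R * cent k <= n%:R * (erate + e / 2) by rewrite ler_pM2l // ltW.
by rewrite !mulrDr; lra.
Unshelve. all: by end_near. Qed.

End Markov.

(** * Maximal ergodic inequality *)

Section Ergodic.
Variables (R : realType) (P : probability binseq R).
Hypotheses (Pst : stationary P) (Perg : ergodic P).

(** The maximum of the Birkhoff sums of length 0 to n, in the recursive form that suits Garsia's
    argument. *)
Fixpoint maxsum (f : binseq -> R) n (x : binseq) : R :=
  if n is m.+1 then Num.max 0 (f x + maxsum f m (shift x)) else 0.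

Lemma local_maxsum f k n : local k f -> local (n + k) (maxsum f n).
Proof.
move=> lf; elim: n => [//|n ih] x y xy /=.
rewrite (lf _ _ (word_le _ xy)) ?leqW ?leq_addl //.
by rewrite (ih _ _ (word_shift xy)).
Qed.

Lemma maxsum_ge0 f n x : 0 <= maxsum f n x.
Proof. by case: n => [|n] //=; rewrite le_max lexx. Qed.

Lemma maxsum_leS f n x : maxsum f n x <= maxsum f n.+1 x.
Proof.
elim: n x => [|n ih] x; first exact: maxsum_ge0.
by rewrite [leLHS]/= [leRHS]/= le_max2 // lerD2l.
Qed.

Lemma birkhoff_le_maxsum f n x : birkhoff f n x <= maxsum f n x.
Proof.
elim: n x => [|n ih] x //=.
by rewrite le_max lerD2l ih orbT.
Qed.

Lemma prE n (A : pred binseq) : pr P n A = mean P n (fun x => (A x)%:R).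
Proof.
rewrite /pr big_mkcond; apply: eq_bigr => w _.
by case: (A _); rewrite ?mulr1 ?mulr0.
Qed.

Lemma pr_ge0 n A : 0 <= pr P n A.
Proof. by apply: sumr_ge0 => w _; exact: marginal_ge0. Qed.

Lemma prC n (A : pred binseq) : pr P n (predC A) = 1 - pr P n A.
Proof.
rewrite -(mean_cst P n 1) !prE -[- _]mulN1r -meanZ -meanD.
by apply: eq_mean => w _ /=; case: (A _); rewrite /=; lra.
Qed.

(* The argument of Garsia: on [0 < maxsum f n.+1 x] the maximum is
   [f x + maxsum f n (shift x)]. *)
Lemma maximal_ergodic f k n : local k f ->
  0 <= mean P (n.+1 + k) (fun x => f x * (0 < maxsum f n.+1 x)%R%:R).
Proof.
move=> lf; have lM := local_maxsum (n := n) lf.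
have : mean P (n + k).+1 (maxsum f n \o shift) <=
       mean P (n + k).+1 (maxsum f n.+1).
  rewrite mean_shift // -(mean_widen P (leqnSn _) lM).
  by apply: ler_mean => w _; exact: maxsum_leS.
rewrite -subr_ge0 => /le_trans; apply.
rewrite -mulN1r -meanZ -meanD; apply: ler_mean => w _ /=.
have := maxsum_ge0 f n (shift (ext w)).
set a := f _; set b := maxsum _ _ _ => b0.
have [ab|ab] := leP (a + b) 0.
  by rewrite ltxx mulr0; lra.
by rewrite ab mulr1; lra.
Qed.

Lemma local_bounded (f : binseq -> R) k :
  local k f -> exists B : R, forall x, `|f x| <= B.
Proof.
move=> lf; exists (\sum_(w : k.-tuple bool) `|f (ext w)|) => x.
rewrite (bigD1 (word k x)) //= -(local_ext x lf) lerDl.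
exact: sumr_ge0.
Qed.

Definition unbounded (f : binseq -> R) (j : nat) : set binseq :=
  \bigcup_n [set x | j%:R < birkhoff f n x].

Lemma measurable_unbounded f k j : local k f -> measurable (unbounded f j).
Proof.
move=> lf; apply: bigcupT_measurable => n.
apply: (@measurable_event (n + k) [pred x | j%:R < birkhoff f n x]).
by move=> x y /(local_birkhoff lf) /= ->.
Qed.

(** Dropping or adding the first letter changes a Birkhoff sum by [f x], which the surplus
    [Num.bound] absorbs. The invariance is an exact equality of sets, as [ergodic] demands. *)
Lemma shift_unbounded f :
  shift @^-1` (\bigcap_j unbounded f j) = \bigcap_j unbounded f j.
Proof.
apply/seteqP; split=> x xU j _.
  have [n _ /= jn] := xU (j + Num.bound `|f x|)%N I.
  exists n.+1 => //=; move: jn.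
  have := archi_boundP (normr_ge0 (f x)); have := ler_norm (- f x).
  by rewrite normrN natrD; lra.
have [[|n] _ /=] := xU (j + Num.bound `|f x|)%N I; first by rewrite ltrn0.
move=> jn; exists n => //=; move: jn.
have := archi_boundP (normr_ge0 (f x)); have := ler_norm (f x).
by rewrite natrD; lra.
Qed.

(** By ergodicity the probability is 0 or 1. If it were 1, the events [0 < maxsum f n x] would
    increase to full probability, and the maximal ergodic inequality would make the mean of [f]
    nonnegative. *)
Lemma unbounded0 f k : local k f -> mean P k f < 0 ->
  P (\bigcap_j unbounded f j) = 0%E.
Proof.
move=> lf f0.
have mU : measurable (\bigcap_j unbounded f j).
  by apply: bigcapT_measurable => j; exact: measurable_unbounded lf.
have [//|P1] := Perg mU (shift_unbounded f).
have [B fB] := local_bounded lf.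
pose F n := [set x | 0 < maxsum f n x].
have FE n : P (F n) = (pr P (n + k) [pred x | (0 < maxsum f n x)%R])%:E.
  by apply: prob_event => x y /(local_maxsum lf) /= ->.
have mF n : measurable (F n).
  apply: (@measurable_event (n + k) [pred x | 0 < maxsum f n x]).
  by move=> x y /(local_maxsum lf) /= ->.
have mbF : measurable (\bigcup_n F n) by exact: bigcupT_measurable.
have PF : P (\bigcup_n F n) = 1%E.
  apply/le_anti; rewrite probability_le1 //= -P1 le_measure ?inE //.
  move=> x /(_ 0%N I) [n _ /= xn]; exists n => //=.
  exact: lt_le_trans xn (birkhoff_le_maxsum _ _ _).
have ndF : nondecreasing_seq F.
  apply/nondecreasing_seqP => n; apply/subsetPset => x /= x0.
  exact: lt_le_trans x0 (maxsum_leS _ _ _).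
have : fine \o (P \o F) @ \oo --> (1 : R).
  by apply: fine_cvg; rewrite -PF; exact: nondecreasing_cvg_mu.
have B0 : 0 <= B by apply: le_trans (fB (fun=> false)).
set m := mean P k f in f0.
(* A missing mass below this tolerance, times the bound [B], stays below [- m]; the added 1 keeps
   the denominator positive. *)
have e0 : 0 < - m / (B + 1) by rewrite divr_gt0 ?oppr_gt0 // ltr_wpDl.
move=> /cvgrPdist_lt/(_ _ e0) [n _ /(_ n.+1 (leqnSn n))] h.
pose q := pr P (n.+1 + k) [pred x | 0 < maxsum f n.+1 x].
have {}h : `|1 - q| < - m / (B + 1) by move: h; rewrite /comp FE.
have := maximal_ergodic n lf.
(* Off the event, [f x + B] is nonnegative and so dominates the vanishing left side. *)
have : mean P (n.+1 + k) (fun x => f x * (0 < maxsum f n.+1 x)%R%:R) <=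
    mean P (n.+1 + k)
      (fun x => f x + B * (predC [pred x | 0 < maxsum f n.+1 x] x)%:R).
  apply: ler_mean => w _ /=; have := fB (ext w).
  by rewrite ler_norml => /andP[]; case: ltP => _ /=; lra.
rewrite meanD meanZ -prE prC (mean_widen P _ lf) ?leq_addl // -/m.
rewrite -/q => /[swap] /le_trans/[apply].
have q1 : 0 <= 1 - q by rewrite -prC pr_ge0.
have {}h : (1 - q) * B + (1 - q) < - m.
  by move: h; rewrite ger0_norm // ltr_pdivlMr ?ltr_wpDl // mulrDr mulr1.
rewrite (mulrC B) => mB; exfalso.
by move: h => {PF P1 FE}; lra.
Qed.

Lemma birkhoffB (f : binseq -> R) c n x :
  birkhoff (fun y => f y - c) n x = birkhoff f n x - n%:R * c.
Proof.
elim: n x => [|n ih] x /=; first by rewrite mul0r subr0.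
by rewrite ih -natr1 mulrDl; lra.
Qed.

(** With [c0] strictly between the mean and [c], a Birkhoff sum of [f] above [n c] makes that of
    [f - c0] exceed [n (c - c0)], hence any fixed j for large n; [unbounded0] makes this rare. *)
Lemma birkhoff_upper (f : binseq -> R) k c e :
  local k f -> mean P k f < c -> 0 < e ->
  \forall n \near \oo, pr P (n + k) [pred x | n%:R * c < birkhoff f n x] < e.
Proof.
move=> lf fc e0; pose c0 := (mean P k f + c) / 2.
have [f0 c0c] : mean P k f < c0 /\ c0 < c by rewrite /c0; split; lra.
pose g x := f x - c0.
have lg : local k g by move=> x y /lf; rewrite /g => ->.
have g0 : mean P k g < 0.
  by rewrite /g meanD mean_cst subr_lt0.
have mU j := measurable_unbounded j lg.
have : fine \o (P \o unbounded g) @ \oo --> (0 : R).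
  apply: fine_cvg; rewrite -[0%:E](unbounded0 lg g0).
  apply: nonincreasing_cvg_mu => //.
  - by rewrite (le_lt_trans (probability_le1 _ _)) ?ltry.
  - exact: bigcapT_measurable.
  - apply/nonincreasing_seqP => j; apply/subsetPset => x [n _ /= xn].
    by exists n => //=; apply: le_lt_trans xn; rewrite ler_nat.
move=> /cvgrPdist_lt/(_ _ e0) [j _ /(_ j (leqnn j))] /=.
rewrite sub0r normrN ger0_norm ?fine_ge0 // => Uj.
near=> n; apply: le_lt_trans Uj.
have lA : local (n + k) [pred x | n%:R * c < birkhoff f n x].
  by move=> x y /(local_birkhoff lf) /= ->.
rewrite -lee_fin fineK ?fin_num_measure // -prob_event // le_measure ?inE //.
  exact: measurable_event lA.
move=> x /= xn; exists n => //=; rewrite birkhoffB.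
have : j%:R < n%:R * (c - c0) by near: n; apply: near_inv_natr_lt; rewrite subr_gt0.
by rewrite mulrBr; lra.
Unshelve. all: by end_near. Qed.

End Ergodic.

(** * Equipartition *)

Section Equipartition.
Variables (R : realType) (P : probability binseq R).
Hypotheses (Pst : stationary P) (Perg : ergodic P).
Local Notation h := (erate P).

Lemma pr_widen m n (A : pred binseq) : (m <= n)%N -> local m A ->
  pr P n A = pr P m A.
Proof.
by move=> mn lA; rewrite !prE; apply: mean_widen => // x y /lA ->.
Qed.

(** Markov's inequality for the likelihood ratio of [bmarkov] to [wmass], whose mean is at most the
    total mass of [bmarkov]. *)
Lemma pr_bmarkov_le k n (a : R) : 0 < a ->
  pr P (n + k) [pred x | wmass P (n + k) x * a < bmarkov P k n x] <= a^-1.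
Proof.
move=> a0; rewrite -[leRHS]mulr1.
apply: le_trans (ler_wpM2l _ (sum_bmarkov_le1 Pst k n));
  last by rewrite invr_ge0 ltW.
rewrite mulr_sumr /pr big_mkcond; apply: ler_sum => w _ /=.
case: ifP => [|_]; last by rewrite mulr_ge0 ?invr_ge0 ?bmarkov_ge0 // ltW.
by rewrite wmassE => /ltW ?; rewrite ler_pdivlMl // mulrC.
Qed.

(** The slack [n d] is split: one half for the likelihood ratio, one quarter for the boundary term
    [info k], one quarter for the Birkhoff sum of [cinfo k]. The two exceptional events get [e / 2]
    each. *)
Lemma pr_small_lt d e : 0 < d -> 0 < e -> \forall n \near \oo,
  pr P n [pred x | wmass P n x < expR (- (n%:R * (h + d)))] < e.
Proof.
move=> d0 e0; have d4 : 0 < d / 4 by rewrite divr_gt0.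
have e2 : 0 < e / 2 by rewrite divr_gt0.
have [k kh] := erate_lt Pst d4.
have [C infoC] := local_bounded (@local_info _ P k).
have lci := @local_cinfo _ P k.
have [N _ HN] := birkhoff_upper Pst Perg lci kh e2.
near=> n.
have kn : (N + k <= n)%N by near: n; exact: nbhs_infty_ge.
have [m nE] : exists m, n = (m + k)%N.
  by exists (n - k)%N; rewrite subnK // (leq_trans _ kn) // leq_addl.
have Nm : (N <= m)%N by rewrite -(leq_add2r k) -nE.
have nC : C < n%:R * (d / 4) by near: n; exact: near_inv_natr_lt.
have ne : - ln (e / 2) < n%:R * (d / 2).
  by near: n; apply: near_inv_natr_lt; rewrite divr_gt0.
have := HN m Nm; rewrite /= => Bm.
set A := [pred x | _ < _].
pose a := expR (n%:R * (d / 2)).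
pose M := [pred x | wmass P n x * a < bmarkov P k m x].
have lA : local n A by move=> x y /(@local_wmass _ P n) /= ->.
have lM : local n M.
  rewrite nE => x y xy /=.
  by rewrite nE (local_wmass P xy) (local_bmarkov P xy).
have ME : pr P n M < e / 2.
  apply: (@le_lt_trans _ _ a^-1).
    by rewrite /M nE; exact: pr_bmarkov_le (expR_gt0 _).
  by rewrite -[ltRHS]lnK ?posrE // /a -expRN ltr_expR; lra.
(* All events are moved to length n + 1, the number of letters that the Birkhoff sum reads. *)
rewrite -(pr_widen (leqnSn n) lA) prE.
have -> : e = e / 2 + e / 2 by lra.
apply: le_lt_trans (ltrD ME Bm).
rewrite -(pr_widen (leqnSn n) lM) addnS -nE !prE -meanD.
apply: ler_mean => w w0.
have : 0 < wmass P n (ext w).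
  by apply: lt_le_trans (wmass_leS P n _); rewrite wmassE.
move: (ext w) => {w0 w} x x0.
case Ax: (A x) => /=; last by rewrite addr_ge0 ?ler0n.
have [_|Mx] := ltP (wmass P n x * a) (bmarkov P k m x).
  by rewrite lerDl ler0n.
(* A word of small mass outside [M] has small [bmarkov] as well, which forces a large Birkhoff
   sum. *)
rewrite add0r; suff -> : m%:R * (h + d / 4) < birkhoff (cinfo P k) m x by [].
have [m0 mE] : 0 < bmarkov P k m x /\ - ln (bmarkov P k m x) =
    birkhoff (cinfo P k) m x + info P k (iter m shift x).
  by apply: bmarkovP => //; rewrite -nE.
have : ln (bmarkov P k m x) <= ln (wmass P n x) + n%:R * (d / 2).
  rewrite -[n%:R * _]expRK -lnM ?posrE ?expR_gt0 //.
  by rewrite ler_ln ?posrE ?mulr_gt0 ?expR_gt0.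
have : ln (wmass P n x) < - (n%:R * (h + d)).
  by rewrite -[ltRHS]expRK ltr_ln ?posrE ?expR_gt0.
have := infoC (iter m shift x); rewrite ger0_norm ?info_ge0 //.
have : m%:R * (h + d / 4) <= n%:R * (h + d / 4).
  by rewrite ler_wpM2r ?addr_ge0 ?erate_ge0 ?(ltW d4) // ler_nat nE leq_addr.
move: mE nC; rewrite !mulrDr; lra.
Unshelve. all: by end_near. Qed.

(** The mean information is at least [n h]. It is at most about [n (h + d')] off [B], and words in
    [L] fall short of that by [n (d + d')], so their mass is small once the share of [B] is
    controlled. *)
Lemma pr_large_lt d e : 0 < d -> 0 < e -> \forall n \near \oo,
  pr P n [pred x | expR (- (n%:R * (h - d))) < wmass P n x] < e.
Proof.
move=> d0 e0; have de0 : 0 < d * e by rewrite mulr_gt0.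
(* The budget [n d e] has three equal shares: the excess [n d'], the contribution of [B] (mass below
   [d e / 6], with [ln 2 < 2]), and the constant 1. *)
pose d' := d * e / 3; have d'0 : 0 < d' by rewrite divr_gt0.
have de6 : 0 < d * e / 6 by rewrite divr_gt0.
near=> n.
have n0 : 0 < n%:R :> R by rewrite ltr0n; near: n; exact: nbhs_infty_gt.
set L := [pred x | _ < _].
pose B := [pred x | wmass P n x < expR (- (n%:R * (h + d')))].
have Be : pr P n B < d * e / 6 by rewrite /B; near: n; exact: pr_small_lt d'0 de6.
have nd : 1 < n%:R * d' by near: n; exact: near_inv_natr_lt.
(* Information on [B] has no uniform bound, so words there are compared with the uniform mass [u]:
   the cost is [n ln 2] per unit of mass plus an error that sums to at most 1. *)
pose u : R := 2 ^- n.
have u0 : 0 < u by rewrite invr_gt0 exprn_gt0.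
have lnu : - ln u = n%:R * ln 2.
  by rewrite lnV ?posrE ?exprn_gt0 // lnXn // opprK mulr_natl.
have ln20 : 0 <= ln 2 :> R by rewrite ln_ge0 // ler1n.
have ln22 : ln 2 < 2 :> R by exact: ln_sublinear.
have h0 := erate_ge0 Pst.
have : ent P n <= mean P n (fun x => n%:R * (h + d')
    + (- (n%:R * (d + d'))) * (L x)%:R + n%:R * ln 2 * (B x)%:R) +
    \sum_(w : n.-tuple bool) u.
  rewrite -big_split; apply: ler_sum => w _ /=.
  rewrite /info wmassE; have := marginal_ge0 P w.
  set p := marginal P w => p0.
  have -> : n%:R * (h - d) = n%:R * (h + d') - n%:R * (d + d') by ring.
  have : 0 <= p * (n%:R * (h + d')) by rewrite !mulr_ge0 ?addr_ge0 // ltW.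
  have : 0 <= n%:R * ln 2 :> R by rewrite mulr_ge0 // ltW.
  move: (n%:R * (h + d')) (n%:R * (d + d')) (n%:R * ln 2) lnu => X Y Z lnu Z0 X0.
  have [pL|pL] := ltP (expR (- (X - Y))) p.
    have p1 : 0 < p by apply: lt_trans pL; exact: expR_gt0.
    have := pL; rewrite -{1}[p]lnK ?posrE // ltr_expR ltrNl => /ltW/(ler_wpM2l p0).
    have : 0 <= p * (Z * (p < expR (- X))%R%:R) by rewrite !mulr_ge0.
    rewrite mulr1; lra.
  rewrite mulr0 addr0.
  have [pB|pB] := ltP p (expR (- X)).
    have := gibbs_term p0 (ltW u0) (fun=> u0).
    rewrite lnu mulr1; lra.
  have p1 : 0 < p by apply: lt_le_trans pB; exact: expR_gt0.
  move: pB; rewrite -{1}[p]lnK ?posrE // ler_expR lerNl => /(ler_wpM2l p0).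
  rewrite mulr0 addr0; lra.
rewrite sumr_const card_tuple card_bool -[u *+ _]mulr_natr natrX mulVf ?expf_neq0 //.
rewrite !meanD !meanZ mean_cst -!prE => /(le_trans (ent_ge Pst n)).
have nB : n%:R * ln 2 * pr P n B <= n%:R * (2 * (d * e / 6)).
  rewrite -mulrA ler_pM2l // ler_pM ?pr_ge0 // ltW //.
have : 0 <= d' * pr P n L by rewrite mulr_ge0 ?pr_ge0 // ltW.
move=> dL H; rewrite -(ltr_pM2l d0) -(ltr_pM2l n0).
have : 0 <= n%:R * (d' * pr P n L) by rewrite mulr_ge0 // ltW.
move: nd nB H; rewrite /d' !mulrDr ?mulrDl ?mulNr ?mulrDl.
have -> : n%:R * (d * e) =
    n%:R * (d * e / 3) + n%:R * (2 * (d * e / 6)) + n%:R * (d * e / 3).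
  by field.
rewrite !mulrA; lra.
Unshelve. all: by end_near. Qed.

End Equipartition.

(** * Smooth Renyi entropies of a finite distribution *)

Section RenyiBounds.
Variables (R : realType) (Z : finType).
Implicit Types (p q : Z -> R) (r s t e : R) (G : pred Z).

Lemma lne_le r t : r <= expR t -> (lne r%:E <= t%:E)%E.
Proof.
have [r0|r0] := ltP 0 r; last by rewrite le0_lneNy ?lee_fin // leNye.
by move=> rt; rewrite lne_EFin // lee_fin -[leRHS]expRK ler_ln ?posrE ?expR_gt0.
Qed.

Lemma lne_ge r t : expR t <= r -> (t%:E <= lne r%:E)%E.
Proof.
move=> tr; have r0 : 0 < r by apply: lt_le_trans tr; exact: expR_gt0.
by rewrite lne_EFin // lee_fin -[leLHS]expRK ler_ln ?posrE ?expR_gt0.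
Qed.

(** Summing over the support only makes order 0 count the support, so one formula covers every real
    order. *)
Definition power_sum r q : R := \sum_(z | 0 < q z) q z `^ r.

Lemma renyi_finE r q : (forall z, 0 <= q z) ->
  renyi_entropy r%:E q = (((1 - r)^-1)%:E * lne (power_sum r q)%:E)%E.
Proof.
move=> q0; rewrite /renyi_entropy /power_sum; case: eqVneq => [->|r0].
  rewrite subr0 invr1 mul1e (eq_bigr (fun=> 1)) => [|z _]; last exact: powRr0.
  by rewrite sumr_const.
congr (_ * lne _%:E)%E; rewrite [RHS]big_mkcond; apply: eq_bigr => z _.
case: ifPn => // qz; have -> : q z = 0 by apply/le_anti; rewrite q0 andbT leNgt.
by rewrite powR0.
Qed.

Lemma powR_expR r (x : R) : 0 < x -> x `^ r = x * expR ((1 - r) * - ln x).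
Proof.
move=> x0; rewrite /powR gt_eqF // -{2}[x]lnK ?posrE // -expRD.
by congr expR; ring.
Qed.

(** Each power is [q z] times the exponential of [(1 - r) * - ln (q z)]. The factor [1 - r] is kept
    in the hypothesis so that orders on both sides of 1 are covered. *)
Lemma power_sum_le r q t : (forall z, 0 <= q z) -> \sum_z q z <= 1 ->
  (forall z, 0 < q z -> (1 - r) * - ln (q z) <= (1 - r) * t) ->
  power_sum r q <= expR ((1 - r) * t).
Proof.
move=> q0 q1 qt; rewrite -[leRHS]mul1r.
apply: le_trans (ler_wpM2r (expR_ge0 _) q1).
rewrite mulr_suml /power_sum big_mkcond; apply: ler_sum => z _.
case: ifPn => [qz|_]; last by rewrite mulr_ge0 ?expR_ge0.
by rewrite powR_expR // ler_pM2l // ler_expR qt.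
Qed.

Lemma power_sum_ge r q s t G : (forall z, 0 <= q z) ->
  0 < s -> s <= \sum_(z | G z) q z ->
  (forall z, G z -> 0 < q z -> (1 - r) * t <= (1 - r) * - ln (q z)) ->
  expR ((1 - r) * t + ln s) <= power_sum r q.
Proof.
move=> q0 s0 sG qt; rewrite expRD lnK ?posrE //.
apply: le_trans (ler_wpM2l (expR_ge0 _) sG) _.
rewrite mulr_sumr /power_sum big_mkcond [leRHS]big_mkcond.
apply: ler_sum => z _; have := q0 z.
rewrite le_eqVlt => /predU1P[<-|qz]; first by rewrite ltxx mulr0 if_same.
rewrite qz; case: ifPn => [Gz|_]; last exact: powR_ge0.
by rewrite powR_expR // mulrC ler_pM2l // ler_expR qt.
Qed.

Definition truncation G p : Z -> R := fun z => if G z then p z else 0.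

Lemma truncation_smoothing G p e : (forall z, 0 <= p z) -> \sum_z p z = 1 ->
  \sum_(z | ~~ G z) p z <= e -> smoothing_set e p (truncation G p).
Proof.
move=> p0 p1 pe; split.
  by rewrite /truncation -big_mkcond /= -p1 (bigID G) /=; lra.
by move=> z; rewrite /truncation; case: ifP; rewrite ?lexx p0.
Qed.

(** In total [q] keeps mass [1 - e], and outside [G] it is dominated by [p]. *)
Lemma smoothing_mass G p q e eta : smoothing_set e p q ->
  \sum_(z | ~~ G z) p z <= eta -> 1 - e - eta <= \sum_(z | G z) q z.
Proof.
move=> [qe qp] pG; move: qe; rewrite (bigID G) /=.
have : \sum_(z | ~~ G z) q z <= \sum_(z | ~~ G z) p z.
  by apply: ler_sum => z _; case/andP: (qp z).
lra.
Qed.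

(* On [expR (- t) <= p], the words with [q] below the threshold have [q]-mass
   at most half of [s]. *)
Lemma smoothing_heavy p q s t : (forall z, 0 <= p z) -> \sum_z p z = 1 ->
  (forall z, 0 <= q z) -> 0 < s -> s <= \sum_(z | expR (- t) <= p z) q z ->
  s / 2 <= \sum_(z | expR (- (t - ln (s / 2))) <= q z) q z.
Proof.
move=> p0 p1 q0 s0; have s2 : 0 < s / 2 by rewrite divr_gt0.
rewrite opprB addrC expRD lnK ?posrE // => sG.
suff : \sum_(z | expR (- t) <= p z) q z <=
    \sum_(z | expR (- t) * (s / 2) <= q z) q z + s / 2 * \sum_z p z.
  by rewrite p1; lra.
rewrite mulr_sumr [leLHS]big_mkcond [X in X + _]big_mkcond -big_split /=.
apply: ler_sum => z _.
have sp : 0 <= s / 2 * p z by rewrite mulr_ge0 // ltW.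
have [tp|_] := leP (expR (- t)) (p z); last first.
  by case: ifP => _; rewrite ?addr_ge0 ?add0r.
have [_|qt] := leP (expR (- t) * (s / 2)) (q z); first by rewrite lerDl.
by rewrite add0r (le_trans (ltW qt)) // mulrC ler_pM2l.
Qed.

End RenyiBounds.

(** The constant depends only on the order and on [s], so it vanishes after division by n. One bound
    uses a truncation of [p] as a member of the smoothing set; the other holds for every member,
    through the mass it keeps on typical words. *)
Lemma smooth_renyi_bounds (R : realType) (a : \bar R) (s : R) :
  (0 <= a)%E -> a <> 1%E -> 0 < s -> exists C : R,
  forall (Z : finType) (p : Z -> R) (e eta t1 t2 : R),
    (forall z, 0 <= p z) -> \sum_z p z = 1 ->
    eta <= e -> s <= 1 - e - eta ->
    \sum_(z | p z < expR (- t2)) p z <= eta ->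
    \sum_(z | expR (- t1) < p z) p z <= eta ->
    ((t1 - C)%:E <= smooth_renyi_entropy a e p)%E /\
    (smooth_renyi_entropy a e p <= (t2 + C)%:E)%E.
Proof.
move=> a0 a1 s0; have s2 : 0 < s / 2 by rewrite divr_gt0.
have s2le : s / 2 <= s by lra.
pose lower C := forall (Z : finType) (p : Z -> R) (e eta t1 : R),
    (forall z, 0 <= p z) -> \sum_z p z = 1 ->
    eta <= e -> s <= 1 - e - eta ->
    \sum_(z | expR (- t1) < p z) p z <= eta ->
    ((t1 - C)%:E <= smooth_renyi_entropy a e p)%E.
pose upper C := forall (Z : finType) (p : Z -> R) (e eta t2 : R),
    (forall z, 0 <= p z) -> \sum_z p z = 1 ->
    eta <= e -> s <= 1 - e - eta ->
    \sum_(z | p z < expR (- t2)) p z <= eta ->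
    (smooth_renyi_entropy a e p <= (t2 + C)%:E)%E.
suff [C1 [C2 [lo up]]] : exists C1 C2, lower C1 /\ upper C2.
  exists (Num.max C1 C2) => Z p e eta t1 t2 p0 p1 ee se small large; split.
    apply: le_trans (lo _ _ _ _ _ p0 p1 ee se large).
    by rewrite lee_fin lerD2l lerN2 le_max lexx.
  apply: (le_trans (up _ _ _ _ _ p0 p1 ee se small)).
  by rewrite lee_fin lerD2l le_max lexx orbT.
have trunc_lo (Z : finType) (p : Z -> R) (e eta t1 : R) :
    (forall z, 0 <= p z) -> \sum_z p z = 1 -> eta <= e ->
    \sum_(z | expR (- t1) < p z) p z <= eta ->
    smoothing_set e p (truncation [pred z | p z <= expR (- t1)] p).
  move=> p0 p1 ee large; apply: truncation_smoothing => //=.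
  by under eq_bigl do rewrite -ltNge; exact: le_trans large ee.
have trunc_up (Z : finType) (p : Z -> R) (e eta t2 : R) :
    (forall z, 0 <= p z) -> \sum_z p z = 1 -> eta <= e ->
    \sum_(z | p z < expR (- t2)) p z <= eta ->
    smoothing_set e p (truncation [pred z | expR (- t2) <= p z] p).
  move=> p0 p1 ee small; apply: truncation_smoothing => //=.
  by under eq_bigl do rewrite -ltNge; exact: le_trans small ee.
have trunc0 (Z : finType) G (p : Z -> R) z :
    (forall z, 0 <= p z) -> 0 <= truncation G p z.
  by move=> p0; rewrite /truncation; case: ifP.
have trunc1 (Z : finType) G (p : Z -> R) :
    (forall z, 0 <= p z) -> \sum_z p z = 1 -> \sum_z truncation G p z <= 1.
  by move=> p0 <-; apply: ler_sum => z _; rewrite /truncation; case: ifP.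
(* Above order 1 the values of [q] itself must be bounded below, which [q <= p] does not give;
   lowering the threshold by the factor [s / 2] retains enough mass. *)
have heavy (Z : finType) (p q : Z -> R) (e eta t2 : R) :
    (forall z, 0 <= p z) -> \sum_z p z = 1 -> s <= 1 - e - eta ->
    \sum_(z | p z < expR (- t2)) p z <= eta -> smoothing_set e p q ->
    s / 2 <= \sum_(z | expR (- (t2 - ln (s / 2))) <= q z) q z.
  move=> p0 p1 se small qe; have q0 z : 0 <= q z by case/andP: (qe.2 z).
  apply: (smoothing_heavy p0 p1 q0 s0); apply: (le_trans se).
  by apply: smoothing_mass qe _; under eq_bigl do rewrite -ltNge.
have light (Z : finType) (p q : Z -> R) (e eta t1 : R) : s <= 1 - e - eta ->
    \sum_(z | expR (- t1) < p z) p z <= eta -> smoothing_set e p q ->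
    s <= \sum_(z | p z <= expR (- t1)) q z.
  move=> se large qe; apply: (le_trans se).
  by apply: smoothing_mass qe _; under eq_bigl do rewrite -ltNge.
case: a a0 a1 @lower @upper => [r| |] // r0 r1 lower upper; last first.
  exists 0, (- ln (s / 2)); split=> Z p e eta t p0 p1 ee se pt.
    rewrite subr0; apply: le_ereal_sup_tmp; eexists.
      by exists (truncation [pred z | p z <= expR (- t)] p) => //; exact: trunc_lo pt.
    rewrite leeNr -EFinN; apply: lne_le; apply/bigmax_leP.
    split=> [|z _]; first exact: expR_ge0.
    by rewrite /truncation; case: ifP => //; rewrite expR_ge0.
  apply: ge_ereal_sup => _ [q qe <-].
  rewrite leeNl -EFinN; apply: lne_ge.
  have := heavy _ _ _ _ _ _ p0 p1 se pt qe.
  (* At order [+oo] a single word above the threshold suffices; without one the sum would be empty,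
     against [0 < s / 2]. *)
  have [/existsP[z qz] _|] := boolP [exists z, expR (- (t - ln (s / 2))) <= q z].
    exact: le_trans qz (le_bigmax _ _ _).
  rewrite negb_exists => /forallP nq; rewrite big_pred0 => [|z]; first by lra.
  exact/negbTE/nq.
have [r1'|r1'] := ltP r 1.
  (* Chosen so that [(1 - r) * (t - C)] equals [(1 - r) * t + ln s], the exponent in
     [power_sum_ge]. *)
  exists (- ln s / (1 - r)), 0.
  have r1'' : 0 < 1 - r by rewrite subr_gt0.
  rewrite /lower /upper /smooth_renyi_entropy lte_fin r1'.
  split=> Z p e eta t p0 p1 ee se pt.
    apply: le_ereal_inf_tmp => _ [q qe <-].
    have q0 z : 0 <= q z by case/andP: (qe.2 z).
    rewrite renyi_finE // lee_pdivlMl //.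
    apply: lne_ge.
    apply: le_trans (power_sum_ge (t := t) q0 s0
      (light _ _ _ _ _ _ se pt qe) _).
      rewrite ler_expR le_eqVlt; apply/orP; left; apply/eqP.
      by field; rewrite gt_eqF.
    move=> z pz qz; rewrite ler_pM2l // lerNr.
    rewrite -[leRHS]expRK ler_ln ?posrE ?expR_gt0 //.
    by apply: le_trans pz; case/andP: (qe.2 z).
  rewrite addr0; apply: ge_ereal_inf; eexists.
    by exists (truncation [pred z | expR (- t) <= p z] p) => //; exact: trunc_up pt.
  rewrite renyi_finE => [|z]; last exact: trunc0.
  rewrite lee_pdivrMl //; apply: lne_le; apply: power_sum_le => [z||z].
  - exact: trunc0.
  - exact: trunc1.
  rewrite /truncation /=; case: ifP => [tp pz|_]; last by rewrite ltxx.
  by rewrite ler_pM2l // lerNl -[leLHS]expRK ler_ln ?posrE ?expR_gt0.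
have {}r1' : 1 < r.
  by rewrite lt_neqAle r1' andbT; apply/eqP => r1E; apply: r1; rewrite r1E.
have r1'' : 1 - r < 0 by rewrite subr_lt0.
have r1F : (r%:E < 1)%E = false by rewrite lte_fin ltNge (ltW r1').
(* The first term is the lowered threshold of [heavy], the second the mass [s / 2] of the words
   above it. *)
exists 0, (- ln (s / 2) + ln (s / 2) / (1 - r)).
rewrite /lower /upper /smooth_renyi_entropy r1F.
split=> Z p e eta t p0 p1 ee se pt.
  rewrite subr0; apply: le_ereal_sup_tmp; eexists.
    by exists (truncation [pred z | p z <= expR (- t)] p) => //; exact: trunc_lo pt.
  rewrite renyi_finE => [|z]; last exact: trunc0.
  rewrite lee_ndivlMl //; apply: lne_le; apply: power_sum_le => [z||z].
  - exact: trunc0.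
  - exact: trunc1.
  rewrite /truncation /=; case: ifP => [tp pz|_]; last by rewrite ltxx.
  by rewrite ler_nM2l // lerNr -[leRHS]expRK ler_ln ?posrE ?expR_gt0.
apply: ge_ereal_sup => _ [q qe <-].
have q0 z : 0 <= q z by case/andP: (qe.2 z).
rewrite renyi_finE // lee_ndivrMl //; apply: lne_ge.
apply: le_trans (power_sum_ge (t := t - ln (s / 2)) q0 s2
  (heavy _ _ _ _ _ _ p0 p1 se pt qe) _).
  rewrite ler_expR le_eqVlt; apply/orP; left; apply/eqP.
  by field; rewrite lt_eqF.
move=> z pz qz; rewrite ler_nM2l // lerNl.
by rewrite -[leLHS]expRK ler_ln ?posrE ?expR_gt0.
Qed.

(** * Rates *)

Section SmoothRate.
Variables (R : realType) (P : probability binseq R) (a : \bar R) (e : R).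
Hypotheses (Pst : stationary P) (Perg : ergodic P).
Hypotheses (a0 : (0 <= a)%E) (a1 : a <> 1%E) (e01 : 0 < e < 1).

Lemma block_smooth_renyi_near (d : R) : 0 < d ->
  \forall n \near \oo, ((erate P - d)%:E <= block_smooth_renyi P a e n)%E /\
    (block_smooth_renyi P a e n <= (erate P + d)%:E)%E.
Proof.
case/andP: e01 => e0 e1 d0.
have d2 : 0 < d / 2 by rewrite divr_gt0.
(* Half of [1 - e] is retained as [s], and [eta] takes at most the other half; [eta <= e] keeps the
   truncations inside the smoothing set. *)
pose s := (1 - e) / 2; pose eta := Num.min e s.
have s0 : 0 < s by rewrite divr_gt0 ?subr_gt0.
have eta0 : 0 < eta by rewrite lt_min e0.
have etae : eta <= e by rewrite ge_min lexx.
have etas : s <= 1 - e - eta.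
  have : eta <= s by rewrite ge_min lexx orbT.
  by move: eta {eta0 etae} => u; rewrite /s; lra.
have [C HC] := smooth_renyi_bounds a0 a1 s0.
near=> n.
have n0 : 0 < n%:R :> R by rewrite ltr0n; near: n; exact: nbhs_infty_gt.
have Cn : C < n%:R * (d / 2) by near: n; exact: near_inv_natr_lt.
have small :
  pr P n [pred x | wmass P n x < expR (- (n%:R * (erate P + d / 2)))] < eta.
  by near: n; exact: (pr_small_lt Pst Perg d2 eta0).
have large :
  pr P n [pred x | expR (- (n%:R * (erate P - d / 2))) < wmass P n x] < eta.
  by near: n; exact: (pr_large_lt Pst Perg d2 eta0).
have [||lo up] := HC _ (marginal P (n:=n)) e eta (n%:R * (erate P - d / 2))
    (n%:R * (erate P + d / 2)) (@marginal_ge0 _ P n) (sum_marginal P n) etae etas.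
- by move: small => /ltW; rewrite /pr; under eq_bigl do rewrite /= wmassE.
- by move: large => /ltW; rewrite /pr; under eq_bigl do rewrite /= wmassE.
rewrite /block_smooth_renyi lee_pdivlMl // lee_pdivrMl //; split.
  by apply: le_trans lo; rewrite -EFinM lee_fin; lra.
by apply: (le_trans up); rewrite -EFinM lee_fin; lra.
Unshelve. all: by end_near. Qed.

(** Already for each fixed [e] in (0, 1) the smooth rate is the entropy rate, so the final limit in
    [e] is that of a function constant near 0. *)
Lemma cvg_block_smooth_renyi : block_smooth_renyi P a e @ \oo --> (erate P)%:E.
Proof.
apply: cvg_EFin.
  apply: filterS (block_smooth_renyi_near ltr01) => n [lo up].
  by rewrite fin_numElt (lt_le_trans _ lo) ?ltNyr // (le_lt_trans up) ?ltry.
apply/cvgrPdist_le => d d0; apply: filterS (block_smooth_renyi_near d0) => n [] /=.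
case: (block_smooth_renyi P a e n) => [x| |] //=; rewrite !lee_fin => lo up.
by rewrite ler_distlC lo.
Qed.

End SmoothRate.

(* limn and --> are total, so the existence of the limits defining the two
   rates is asserted explicitly. *)
Theorem theorem5 (R : realType) (P : probability binseq R)
    (hstat : stationary P) (herg : ergodic P)
    (a : \bar R) (ha0 : (0 <= a)%E) (ha1 : a <> 1%E) :
  [/\ cvgn (block_entropy P),
      (\forall e \near 0^'+, cvgn (block_smooth_renyi P a e)) &
      smooth_renyi_rate P a e @[e --> 0^'+] --> (entropy_rate P)%:E].
Proof.
have cvgH : block_entropy P @ \oo --> erate P.
  rewrite (_ : block_entropy P = fun n => n%:R^-1 * ent P n).
    exact: cvg_ent.
  by apply/funext => n; rewrite /block_entropy entE.
have cvgR e : 0 < e < 1 -> block_smooth_renyi P a e @ \oo --> (erate P)%:E.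
  exact: cvg_block_smooth_renyi.
have near01 : \forall e \near (0 : R)^'+, 0 < e < 1.
  near=> e; apply/andP; split; near: e; first exact: nbhs_right_gt.
  exact: nbhs_right_lt.
split.
- by apply/cvg_ex; exists (erate P).
- by apply: filterS near01 => e /cvgR cvge; apply/cvg_ex; exists (erate P)%:E.
- rewrite /entropy_rate (cvg_lim _ cvgH) //.
  apply: cvg_near_cst; apply: filterS near01 => e /cvgR cvge.
  exact: cvg_lim cvge.
Unshelve. all: by end_near. Qed.
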